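(* Let $S$ be a multiplicative set of a commutative ring $R$, and let $\overline{S}=\{a\in R:\exists\, b\in R,\ ab\in S\}$ be its saturation. Then the Grothendieck group of the multiplicative monoid $\overline{S}$ is canonically isomorphic to the group of units $(S^{-1}R)^{\ast}$.
   Context: All rings are commutative. A multiplicative set is a subset containing $1$ and closed under multiplication; $\overline{S}$ is again a multiplicative set. $A^{\ast}$ denotes the group of units of a ring $A$. The Grothendieck group of a (multiplicatively written) commutative monoid $N$ is the set of equivalence classes $[s,t]$ of pairs $(s,t)\in N\times N$ under $(s,t)\sim(s',t')$ iff there is $u\in N$ with $st'u=ts'u$, with operation $[s,t]\cdot[s',t']=[ss',tt']$. For every $s\in\overline{S}$ the element $s/1$ is a unit of $S^{-1}R$; the canonical map from the Grothendieck group of $\overline{S}$ to $(S^{-1}R)^{\ast}$ is $[s,t]\mapsto (s/1)(t/1)^{-1}$. *)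

(* Defs.v *)
From HB Require Import structures.
From mathcomp Require Import all_boot all_order all_algebra.
From mathcomp Require Import boolp.

Set Implicit Arguments.
Unset Strict Implicit.
Unset Printing Implicit Defensive.

Import GRing.Theory.

Local Open Scope quotient_scope.
Local Open Scope ring_scope.

(* Rings are [comPzRingType]s, which include the zero ring: a localization is *)
(* zero as soon as [0 \in S]. Multiplicative sets are the library's           *)
(* [mulrClosed R]. Relations given by an existential statement are turned     *)
(* into boolean ones with the classical [`[< _ >]] of [boolp].                *)

HB.mixin Record Monoid_isComMonoid N of Monoid N := {
  commgC : forall x y : N, (x * y = y * x)%g
}.

#[short(type="comMonoidType")]
HB.structure Definition ComMonoid := {N of Monoid_isComMonoid N & Monoid N}.

HB.instance Definition _ (N : comMonoidType) :=
  SemiGroup.isCommutativeLaw.Build N ( *%g ) commgC.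

Section Grothendieck.
Variable N : comMonoidType.
Local Open Scope group_scope.
Implicit Types (p q : N * N) (s t u : N).

Definition groth_rel p q : bool :=
  `[< exists u, p.1 * q.2 * u = p.2 * q.1 * u >].

Fact groth_rel_refl : reflexive groth_rel.
Proof. by move=> p; apply/asboolP; exists 1; rewrite [p.1 * _]commgC. Qed.

Fact groth_rel_sym : symmetric groth_rel.
Proof.
by move=> p q; apply/asboolP/asboolP=> -[u e]; exists u;
   rewrite [_.1 * _.2]commgC -e [_.2 * _]commgC.
Qed.

Fact groth_rel_trans : transitive groth_rel.
Proof.
move=> q p r /asboolP[u e] /asboolP[v f]; apply/asboolP; exists (q.2 * u * v).
rewrite (AC (2*3) ((1*3*4)*(2*5))) /= e.
by rewrite (AC (3*2) ((2*4*5)*(1*3))) /= f (AC (3*2) ((4*2)*(1*5*3))).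
Qed.

Canonical groth_equiv :=
  EquivRel groth_rel groth_rel_refl groth_rel_sym groth_rel_trans.

Definition groth : Type := {eq_quot groth_rel}.
HB.instance Definition _ : EqQuotient _ groth_rel groth := EqQuotient.on groth.
HB.instance Definition _ := Choice.on groth.

Definition groth_class s t : groth := \pi_groth (s, t).

Lemma groth_classP s t s' t' :
  groth_class s t = groth_class s' t' <-> exists u, s * t' * u = t * s' * u.
Proof. by split=> [/eqmodP/asboolP|?]; last by apply/eqmodP/asboolP. Qed.

Definition groth_mul (x y : groth) : groth :=
  groth_class ((repr x).1 * (repr y).1) ((repr x).2 * (repr y).2).

Definition groth_inv (x : groth) : groth := groth_class (repr x).2 (repr x).1.

Lemma groth_mulE s t s' t' :
  groth_mul (groth_class s t) (groth_class s' t')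
    = groth_class (s * s') (t * t').
Proof.
have /groth_classP[u e] : groth_class (repr (groth_class s t)).1
  (repr (groth_class s t)).2 = groth_class s t.
  by rewrite /groth_class -surjective_pairing reprK.
have /groth_classP[v f] : groth_class (repr (groth_class s' t')).1
  (repr (groth_class s' t')).2 = groth_class s' t'.
  by rewrite /groth_class -surjective_pairing reprK.
apply/groth_classP; exists (u * v).
by rewrite [LHS](AC (2*2*2) ((1*3*5)*(2*4*6))) /= e f (AC (3*3) ((1*4)*(2*5)*(3*6))).
Qed.

Lemma groth_invE s t : groth_inv (groth_class s t) = groth_class t s.
Proof.
have /groth_classP[u e] : groth_class (repr (groth_class s t)).1
  (repr (groth_class s t)).2 = groth_class s t.
  by rewrite /groth_class -surjective_pairing reprK.
by apply/groth_classP; exists u; rewrite -e.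
Qed.

Lemma groth_ind (P : groth -> Prop) :
  (forall s t, P (groth_class s t)) -> forall x, P x.
Proof. by move=> Pcl; elim/quotW=> -[s t]; apply: Pcl. Qed.

Fact groth_mulA : associative groth_mul.
Proof.
by elim/groth_ind=> ? ?; elim/groth_ind=> ? ?; elim/groth_ind=> ? ?;
   rewrite !groth_mulE !mulgA.
Qed.

Fact groth_mulC : commutative groth_mul.
Proof.
elim/groth_ind=> s t; elim/groth_ind=> s' t'.
by rewrite !groth_mulE [s * _]commgC [t * _]commgC.
Qed.

Fact groth_mul1 : left_id (groth_class 1 1) groth_mul.
Proof. by elim/groth_ind=> ? ?; rewrite groth_mulE !mul1g. Qed.

Fact groth_mulV : left_inverse (groth_class 1 1) groth_inv groth_mul.
Proof.
elim/groth_ind=> s t; rewrite groth_invE groth_mulE; apply/groth_classP.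
by exists 1; rewrite [t * s]commgC [LHS]mulg1 [RHS]mulg1 mulg1.
Qed.

Fact groth_mulr1 : right_id (groth_class 1 1) groth_mul.
Proof. by move=> x; rewrite groth_mulC groth_mul1. Qed.

Fact groth_mulrV : right_inverse (groth_class 1 1) groth_inv groth_mul.
Proof. by move=> x; rewrite groth_mulC groth_mulV. Qed.

HB.instance Definition _ :=
  isGroup.Build groth groth_mulA groth_mul1 groth_mulr1 groth_mulV groth_mulrV.

End Grothendieck.

Section Units.
Variable A : comPzRingType.
Implicit Types x y : A.

(* [GRing.unit] is only available for nonzero rings. *)
Definition is_unit : {pred A} := fun x => `[< exists y, x * y = 1 >].

Lemma is_unitP x : reflect (exists y, x * y = 1) (x \in is_unit).
Proof. exact: asboolP. Qed.

Record units : Type := Units { unit_val :> A; _ : unit_val \in is_unit }.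
HB.instance Definition _ := [isSub for unit_val].
HB.instance Definition _ := [Choice of units by <:].

Lemma unitsP (u : units) : exists y, val u * y = 1.
Proof. by have /is_unitP := valP u. Qed.

Lemma mem_units x y : x * y = 1 -> x \in is_unit.
Proof. by move=> e; apply/is_unitP; exists y. Qed.

Definition mk_unit x y (xy1 : x * y = 1) : units := Units (mem_units xy1).

Fact units_mul_subproof (u v : units) : val u * val v \in is_unit.
Proof.
have [x ux] := unitsP u; have [y vy] := unitsP v.
by apply: (@mem_units _ (x * y)); rewrite mulrACA ux vy mulr1.
Qed.

Fact units_inv_subproof (u : units) : sval (cid (unitsP u)) * val u = 1.
Proof. by rewrite mulrC; exact: (svalP (cid (unitsP u))). Qed.

Definition units_one : units := mk_unit (mulr1 (1 : A)).
Definition units_mul (u v : units) : units := Units (units_mul_subproof u v).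
Definition units_inv (u : units) : units := mk_unit (units_inv_subproof u).

Fact units_mulA : associative units_mul.
Proof. by move=> u v w; apply: val_inj; rewrite !SubK mulrA. Qed.

Fact units_mulC : commutative units_mul.
Proof. by move=> u v; apply: val_inj; rewrite !SubK mulrC. Qed.

Fact units_mul1 : left_id units_one units_mul.
Proof. by move=> u; apply: val_inj; rewrite !SubK mul1r. Qed.

Fact units_mulr1 : right_id units_one units_mul.
Proof. by move=> u; rewrite units_mulC units_mul1. Qed.

Fact units_mulV : left_inverse units_one units_inv units_mul.
Proof. by move=> u; apply: val_inj; rewrite !SubK units_inv_subproof. Qed.

Fact units_mulrV : right_inverse units_one units_inv units_mul.
Proof. by move=> u; rewrite units_mulC units_mulV. Qed.

HB.instance Definition _ :=
  isGroup.Build units units_mulA units_mul1 units_mulr1 units_mulV units_mulrV.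

Lemma val_unitsM (u v : units) : val (u * v)%g = val u * val v.
Proof. by []. Qed.

End Units.

Section MulSet.
Variables (R : comPzRingType) (S : mulrClosed R).

Record mulset : Type := MulSet { mulset_val :> R; _ : mulset_val \in S }.
HB.instance Definition _ := [isSub for mulset_val].
HB.instance Definition _ := [Choice of mulset by <:].
Implicit Types s t : mulset.

Definition mulset_one : mulset := MulSet (@rpred1 R S).
Definition mulset_mul s t : mulset :=
  MulSet (rpredM (valP s) (valP t)).

Fact mulset_mulA : associative mulset_mul.
Proof. by move=> ? ? ?; apply: val_inj; rewrite !SubK mulrA. Qed.

Fact mulset_mulC s t : mulset_mul s t = mulset_mul t s.
Proof. by apply: val_inj; rewrite !SubK mulrC. Qed.

Fact mulset_mul1 : left_id mulset_one mulset_mul.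
Proof. by move=> ?; apply: val_inj; rewrite !SubK mul1r. Qed.

Fact mulset_mulr1 : right_id mulset_one mulset_mul.
Proof. by move=> ?; apply: val_inj; rewrite !SubK mulr1. Qed.

HB.instance Definition _ :=
  isMonoid.Build mulset mulset_mulA mulset_mul1 mulset_mulr1.
HB.instance Definition _ := Monoid_isComMonoid.Build mulset mulset_mulC.

Lemma val_mulsetM s t : val (s * t)%g = val s * val t.
Proof. by []. Qed.

Lemma val_mulset1 : val (1%g : mulset) = 1.
Proof. by []. Qed.

Definition saturation : {pred R} := fun a => `[< exists b, a * b \in S >].

Lemma saturationP a : reflect (exists b, a * b \in S) (a \in saturation).
Proof. exact: asboolP. Qed.

Fact saturation_mulr_closed : mulr_closed saturation.
Proof.
split; first by apply/saturationP; exists 1; rewrite mulr1 rpred1.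
move=> a a' /saturationP[b ab] /saturationP[b' ab'].
by apply/saturationP; exists (b * b'); rewrite mulrACA rpredM.
Qed.

HB.instance Definition _ :=
  GRing.isMulClosed.Build R saturation saturation_mulr_closed.

End MulSet.

Section Localization.
Variables (R : comPzRingType) (S : mulrClosed R).
Local Notation D := (mulset S).
Implicit Types (a b : R) (s t u : D) (p q : R * D).

Definition loc_rel p q : bool :=
  `[< exists u : D, p.1 * val q.2 * val u = q.1 * val p.2 * val u >].

Fact loc_rel_refl : reflexive loc_rel.
Proof. by move=> p; apply/asboolP; exists 1%g. Qed.

Fact loc_rel_sym : symmetric loc_rel.
Proof. by move=> p q; apply/asboolP/asboolP=> -[u e]; exists u. Qed.

Fact loc_rel_trans : transitive loc_rel.
Proof.
move=> q p r /asboolP[u e] /asboolP[v f].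
apply/asboolP; exists (q.2 * u * v)%g; rewrite !val_mulsetM.
rewrite (AC (2*3) ((1*3*4)*(2*5))) /= e.
by rewrite (AC (3*2) ((1*4*5)*(2*3))) /= f (AC (3*2) ((1*4)*(2*5*3))).
Qed.

Canonical loc_equiv := EquivRel loc_rel loc_rel_refl loc_rel_sym loc_rel_trans.

Definition loc : Type := {eq_quot loc_rel}.
HB.instance Definition _ : EqQuotient _ loc_rel loc := EqQuotient.on loc.
HB.instance Definition _ := Choice.on loc.

Definition loc_frac a s : loc := \pi_loc (a, s).

Lemma loc_fracP a s b t :
  loc_frac a s = loc_frac b t <->
  exists2 u, u \in S & a * val t * u = b * val s * u.
Proof.
split=> [/eqmodP/asboolP[u e]|[u Su e]].
  by exists (val u) => //; exact: (valP u).
by apply/eqmodP/asboolP; exists (MulSet Su).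
Qed.

Definition loc_add (x y : loc) : loc :=
  let p := repr x in let q := repr y in
  loc_frac (p.1 * val q.2 + q.1 * val p.2) (p.2 * q.2)%g.

Definition loc_opp (x : loc) : loc := loc_frac (- (repr x).1) (repr x).2.

Definition loc_mul (x y : loc) : loc :=
  loc_frac ((repr x).1 * (repr y).1) ((repr x).2 * (repr y).2)%g.

Fact repr_frac a s : exists2 u, u \in S &
  (repr (loc_frac a s)).1 * val s * u = a * val (repr (loc_frac a s)).2 * u.
Proof. by apply/loc_fracP; rewrite /loc_frac -surjective_pairing reprK. Qed.

Lemma loc_addE a s b t : loc_add (loc_frac a s) (loc_frac b t)
  = loc_frac (a * val t + b * val s) (s * t)%g.
Proof.
have [u Su e] := repr_frac a s; have [v Sv f] := repr_frac b t.
apply/loc_fracP; exists (u * v); rewrite ?rpredM // !val_mulsetM !mulrDl.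
congr (_ + _).
  by rewrite [LHS](AC (2*2*2) ((1*3*5)*(2*4*6))) /= e
             [LHS](AC (3*3) ((1*5)*(2*4)*(3*6))).
by rewrite [LHS](AC (2*2*2) ((1*4*6)*(2*3*5))) /= f
           [LHS](AC (3*3) ((1*5)*(4*2)*(6*3))).
Qed.

Lemma loc_mulE a s b t : loc_mul (loc_frac a s) (loc_frac b t)
  = loc_frac (a * b) (s * t)%g.
Proof.
have [u Su e] := repr_frac a s; have [v Sv f] := repr_frac b t.
apply/loc_fracP; exists (u * v); rewrite ?rpredM // !val_mulsetM.
by rewrite [LHS](AC (2*2*2) ((1*3*5)*(2*4*6))) /= e f
           [LHS](AC (3*3) ((1*4)*(2*5)*(3*6))).
Qed.

Lemma loc_oppE a s : loc_opp (loc_frac a s) = loc_frac (- a) s.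
Proof.
have [u Su e] := repr_frac a s.
by apply/loc_fracP; exists u => //; rewrite !mulNr e.
Qed.

Lemma loc_ind (P : loc -> Prop) :
  (forall a s, P (loc_frac a s)) -> forall x, P x.
Proof. by move=> Pfr; elim/quotW=> -[a s]; apply: Pfr. Qed.

Fact loc_addA : associative loc_add.
Proof.
elim/loc_ind=> a s; elim/loc_ind=> b t; elim/loc_ind=> c u.
rewrite !loc_addE !mulgA; congr loc_frac.
by rewrite !val_mulsetM !mulrDl !mulrA !addrA (mulrAC b) (mulrAC c).
Qed.

Fact loc_addC : commutative loc_add.
Proof.
elim/loc_ind=> a s; elim/loc_ind=> b t.
by rewrite !loc_addE addrC [(s * t)%g]commgC.
Qed.

Fact loc_add0 : left_id (loc_frac 0 1%g) loc_add.
Proof.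
by elim/loc_ind=> a s; rewrite loc_addE mul0r add0r mul1g val_mulset1 mulr1.
Qed.

Fact loc_addN : left_inverse (loc_frac 0 1%g) loc_opp loc_add.
Proof.
elim/loc_ind=> a s; rewrite loc_oppE loc_addE; apply/loc_fracP.
by exists 1; rewrite ?rpred1 // mulNr addNr !mul0r.
Qed.

HB.instance Definition _ :=
  GRing.isZmodule.Build loc loc_addA loc_addC loc_add0 loc_addN.

Fact loc_mulA : associative loc_mul.
Proof.
elim/loc_ind=> a s; elim/loc_ind=> b t; elim/loc_ind=> c u.
by rewrite !loc_mulE mulgA mulrA.
Qed.

Fact loc_mulC : commutative loc_mul.
Proof.
elim/loc_ind=> a s; elim/loc_ind=> b t.
by rewrite !loc_mulE mulrC [(s * t)%g]commgC.
Qed.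

Fact loc_mul1 : left_id (loc_frac 1 1%g) loc_mul.
Proof. by elim/loc_ind=> a s; rewrite loc_mulE mul1r mul1g. Qed.

Fact loc_mulDl : left_distributive loc_mul +%R.
Proof.
elim/loc_ind=> a s; elim/loc_ind=> b t; elim/loc_ind=> c u.
rewrite [X in loc_mul X _]loc_addE !loc_mulE [RHS]loc_addE; apply/loc_fracP.
exists 1; rewrite ?rpred1 // !val_mulsetM !mulrDl !mulr1.
by congr (_ + _); rewrite [LHS](AC (3*(2*2)) (1*3*(2*5)*(4*6*7))).
Qed.

HB.instance Definition _ :=
  GRing.Zmodule_isComPzRing.Build loc loc_mulA loc_mulC loc_mul1 loc_mulDl.

Lemma loc_fracM a s b t :
  loc_frac a s * loc_frac b t = loc_frac (a * b) (s * t)%g.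
Proof. exact: loc_mulE. Qed.

Lemma loc_fracD a s b t :
  loc_frac a s + loc_frac b t = loc_frac (a * val t + b * val s) (s * t)%g.
Proof. exact: loc_addE. Qed.

Definition to_loc a : loc := loc_frac a 1%g.

Fact to_loc_zmod_morphism : zmod_morphism to_loc.
Proof.
move=> a b; rewrite [X in _ = _ + X]loc_oppE loc_fracD val_mulset1 !mulr1.
by rewrite mul1g.
Qed.

Fact to_loc_monoid_morphism : GRing.monoid_morphism to_loc.
Proof. by split=> // a b; rewrite loc_fracM mul1g. Qed.

HB.instance Definition _ :=
  GRing.isZmodMorphism.Build R loc to_loc to_loc_zmod_morphism.
HB.instance Definition _ :=
  GRing.isMonoidMorphism.Build R loc to_loc to_loc_monoid_morphism.

Fact to_loc_saturation (s : mulset (saturation S)) :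
  to_loc (val s) \in @is_unit loc.
Proof.
have /saturationP[b sb] := valP s.
apply: (@mem_units _ _ (loc_frac b (MulSet sb))).
rewrite loc_fracM mul1g; apply/loc_fracP.
by exists 1; rewrite ?rpred1 // val_mulset1 mulr1 mul1r.
Qed.

(* The unit [s/1] of the localization, for [s] in the saturation. *)
Definition saturation_unit (s : mulset (saturation S)) : units loc :=
  Units (to_loc_saturation s).

End Localization.

(* Main.v *)
From HB Require Import structures.
Require Import Defs.
From mathcomp Require Import all_boot all_order all_algebra.
From mathcomp Require Import boolp.

Set Implicit Arguments.
Unset Strict Implicit.
Unset Printing Implicit Defensive.

(** The multiplicative map [s |-> s/1] into an abelian group extends to the
    Grothendieck group, and the extension is injective because an equality
    [s/1 = t/1] is witnessed by some [u \in S], which lies in the saturation.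
    It is onto: if [(a/s)(b/t) = 1] then [a b v = s t v] for some [v \in S], so
    that [a] divides an element of [S], hence is in the saturation, and
    [a/s = (a/1)(s/1)^-1]. *)

Section GrothendieckLift.
Variables (N : comMonoidType) (G : groupType) (f : {multiplicative N -> G}).
Hypothesis commG : forall x y : G, (x * y = y * x)%g.
Local Open Scope group_scope.

Definition groth_lift (x : groth N) : G := f (repr x).1 * (f (repr x).2)^-1.

(** Commutativity turns an equality of quotients into the cross-multiplied form used by
    [groth_rel]. *)
Lemma divg_eq_cross (a b c d : G) : a / b = c / d <-> a * d = b * c.
Proof.
split=> [e|e].
  by rewrite -[a](mulgVK b) e -mulgA (commG b d) mulgA mulgVK commG.
by apply/eqP; rewrite divg_eq commG mulgA -e mulgK.
Qed.

Lemma groth_liftE (s t : N) : groth_lift (groth_class s t) = f s / f t.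
Proof.
have /groth_classP[u e] : groth_class (repr (groth_class s t)).1
  (repr (groth_class s t)).2 = groth_class s t.
  by rewrite /groth_class -surjective_pairing reprK.
(* The representative is known only up to the factor [u], whose image cancels in the group [G]. *)
by apply/divg_eq_cross/(mulIg (f u)); rewrite -!gmulfM e.
Qed.

Fact groth_lift_multiplicative : {morph groth_lift : x y / x * y}.
Proof.
elim/groth_ind=> s t; elim/groth_ind=> s' t'.
rewrite [X in groth_lift X]groth_mulE !groth_liftE !gmulfM invgM.
by rewrite -!mulgA; congr (_ * _); rewrite [RHS]commG mulgA.
Qed.

(** Packed explicitly, since multiplicativity rests on the hypothesis [commG]. *)
Definition groth_hom : {multiplicative groth N -> G} :=
  HB.pack_for {multiplicative groth N -> G} groth_lift
    (isMultiplicative.Build (groth N) G groth_lift groth_lift_multiplicative).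

(** After cross-multiplication, equal lifts give two equal values of [f]; the factor [u] then
    supplied is exactly the witness in [groth_rel]. *)
Lemma groth_lift_inj :
  (forall s t, f s = f t -> exists u, s * u = t * u) -> injective groth_lift.
Proof.
move=> finj; elim/groth_ind=> s t; elim/groth_ind=> s' t'.
rewrite !groth_liftE => /divg_eq_cross; rewrite -!gmulfM => /finj e.
exact/groth_classP.
Qed.

End GrothendieckLift.

(** Preimages chosen classically through [cid] form the inverse. *)
Lemma inj_surj_bij (A B : Type) (f : A -> B) :
  injective f -> (forall y, exists x, f x = y) -> bijective f.
Proof.
move=> finj fsurj; have fK y := svalP (cid (fsurj y)).
by exists (fun y => sval (cid (fsurj y))) => x //; apply: finj; rewrite fK.
Qed.

Section SaturationUnits.
Variables (R : comPzRingType) (S : mulrClosed R).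
Local Open Scope ring_scope.
Import GRing.Theory.

Lemma mem_saturation a : a \in S -> a \in saturation S.
Proof. by move=> Sa; apply/saturationP; exists 1; rewrite mulr1. Qed.

Fact saturation_unit_multiplicative :
  {morph @saturation_unit R S : s t / (s * t)%g}.
Proof.
by move=> s t; apply: val_inj; rewrite val_unitsM !SubK rmorphM.
Qed.

HB.instance Definition _ :=
  isMultiplicative.Build (mulset (saturation S)) (units (loc S))
    (@saturation_unit R S) saturation_unit_multiplicative.

Lemma saturation_unit_inj (s t : mulset (saturation S)) :
  saturation_unit s = saturation_unit t -> exists u, (s * u = t * u)%g.
Proof.
move/(congr1 val); rewrite !SubK => /loc_fracP[u Su].
rewrite val_mulset1 !mulr1 => e.
by exists (MulSet (mem_saturation Su)); apply: val_inj.
Qed.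

Lemma loc_frac_to_loc a (s : mulset S) :
  loc_frac a s * to_loc S (val s) = to_loc S a.
Proof.
rewrite loc_fracM mulg1; apply/loc_fracP.
by exists 1; rewrite ?rpred1 // val_mulset1 !mulr1.
Qed.

Lemma loc_frac_unit a (s : mulset S) :
  loc_frac a s \in @is_unit (loc S) -> a \in saturation S.
Proof.
case/is_unitP; elim/loc_ind=> b t; rewrite loc_fracM => /loc_fracP[v Sv].
(* Now [e] equates [a * b * v] with [s * t * v], a product of elements of [S], whence the cofactor
   [b * v]. *)
rewrite val_mulset1 mulr1 mul1r => e; apply/saturationP; exists (b * v).
by rewrite mulrA e rpredM // (valP (s * t)%g).
Qed.

Lemma units_locE (x : units (loc S)) : exists s t : mulset (saturation S),
  x = (saturation_unit s / saturation_unit t)%g.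
Proof.
case: x; elim/loc_ind=> a s xU.
exists (MulSet (loc_frac_unit xU)), (MulSet (mem_saturation (valP s))).
(* Moving the denominator across leaves [a/1 = (a/s)(s/1)]. *)
apply/esym/eqP; rewrite divg_eq; apply/eqP/val_inj.
by rewrite val_unitsM !SubK loc_frac_to_loc.
Qed.

End SaturationUnits.

Theorem corollary4p7 (R : comPzRingType) (S : mulrClosed R) :
  exists phi : {multiplicative groth (mulset (saturation S)) -> units (loc S)},
    bijective phi /\
    forall s t : mulset (saturation S),
      phi (groth_class s t)
        = (saturation_unit s * (saturation_unit t)^-1)%g.
Proof.
have phiE := @groth_liftE _ _ (@saturation_unit R S) (@units_mulC _).
exists (groth_hom (@saturation_unit R S) (@units_mulC _)); split=> //.
apply: inj_surj_bij.
  exact: (groth_lift_inj (@units_mulC _) (@saturation_unit_inj R S)).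
move=> x; have [s [t ->]] := units_locE x; exists (groth_class s t).
exact: phiE.
Qed.
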